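(* Let $w$ be a word in the positive integers, let $|w|$ denote its number of letters, and let $T=P(w)$ be its Hecke insertion tableau. Then $w\overset{|w|}{\equiv}\mathrm{row}(T)$.
   Context: A straight shape is the Young diagram of a partition (rows numbered downward). An increasing tableau is a filling of a straight shape by positive integers that is strictly increasing left to right along rows and down columns. $\mathrm{row}(T)$ is the word obtained by reading the entries of $T$ left to right along each row, starting from the bottom row and moving upward. Hecke insertion. To insert a positive integer $x$ into a (possibly empty) row $R$ of an increasing tableau: Suppose first $x\ge y$ for all $y\in R$. (1) If adjoining a box containing $x$ to the end of $R$ gives an increasing tableau, do so and stop. (2) Otherwise leave $R$ unchanged and stop. If not all entries of $R$ are $\le x$, let $y$ be the smallest entry of $R$ strictly larger than $x$. (3) If replacing $y$ by $x$ gives an increasing tableau, replace $y$ by $x$ and insert $y$ into the next row. (4) Otherwise leave $R$ unchanged and insert $y$ into the next row. $T\leftarrow x$ is the result of inserting $x$ into the first row of $T$ and continuing until the procedure stops. The insertion tableau of $w=w_1\cdots w_n$ is $P(w)=(\cdots((\varnothing\leftarrow w_1)\leftarrow w_2)\cdots\leftarrow w_n)$. A $K$-Knuth move on a word is a replacement of consecutive letters, in either direction, according to one of: $xzy\equiv zxy$ $(x<y<z)$; $yxz\equiv yzx$ $(x<y<z)$; $x\equiv xx$; $xyx\equiv yxy$. For a positive integer $k$, $w\overset{k}{\equiv}w'$ means there is a sequence $w=w_0,w_1,\dots,w_r=w'$ of words such that $w_i$ and $w_{i+1}$ differ by one $K$-Knuth move for each $i$ and every $w_i$ has length at most $k$.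 *)

(* Defs.v *)
From mathcomp Require Import all_boot.

Set Implicit Arguments.
Unset Strict Implicit.
Unset Printing Implicit Defensive.

Definition word := seq nat.

Definition positive_word (w : word) : bool := all (leq 1) w.

(* A filling is the list of its rows, top row first; the empty filling is
   [::], and no stored row of a straight shape is empty. *)
Definition filling := seq (seq nat).

Definition straight_shape (T : filling) : bool :=
  sorted geq (map size T) && all (leq 1) (map size T).

Definition column (T : filling) (j : nat) : seq nat :=
  [seq nth 0 R j | R <- T & j < size R].

Definition increasing_tableau (T : filling) : bool :=
  [&& straight_shape T,
      all positive_word T,
      all (sorted ltn) T
    & all (fun j => sorted ltn (column T j)) (iota 0 (size (head [::] T)))].

Definition row_word (T : filling) : word := flatten (rev T).

(* On an increasing row, the smallest entry strictly larger than x is the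
   first such entry; 0 is a junk value for when there is none. *)
Definition bumped (x : nat) (R : seq nat) : nat :=
  head 0 [seq y <- R | x < y].

Definition replace (y x : nat) (R : seq nat) : seq nat :=
  [seq if z == y then x else z | z <- R].

(* Insertion of x into the first row of [below] (an empty row if [below] is
   empty), within the tableau [above ++ below].  Whether a modification "gives
   an increasing tableau" is tested on the whole tableau. *)
Fixpoint hecke_insert_from (above below : filling) (x : nat) : filling :=
  match below with
  | [::] =>
      if increasing_tableau (rcons above [:: x])
      then rcons above [:: x] else above
  | R :: rest =>
      if all (fun y => y <= x) R then
        if increasing_tableau (above ++ rcons R x :: rest)
        then above ++ rcons R x :: rest else above ++ R :: rest
      else
        let y := bumped x R in
        let R' := replace y x R in
        if increasing_tableau (above ++ R' :: rest)
        then hecke_insert_from (rcons above R') rest y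
        else hecke_insert_from (rcons above R) rest y
  end.

Definition hecke_insert (T : filling) (x : nat) : filling :=
  hecke_insert_from [::] T x.

Definition insertion_tableau (w : word) : filling :=
  foldl hecke_insert [::] w.

Inductive KKnuth_rule : word -> word -> Prop :=
  | KKnuth_xzy x y z : x < y -> y < z ->
      KKnuth_rule [:: x; z; y] [:: z; x; y]
  | KKnuth_yxz x y z : x < y -> y < z ->
      KKnuth_rule [:: y; x; z] [:: y; z; x]
  | KKnuth_idem x : KKnuth_rule [:: x] [:: x; x]
  | KKnuth_braid x y : KKnuth_rule [:: x; y; x] [:: y; x; y].

Definition KKnuth_move (w w' : word) : Prop :=
  exists a u v b : word,
    [/\ KKnuth_rule u v \/ KKnuth_rule v u,
        w = a ++ u ++ b & w' = a ++ v ++ b].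

Definition KKnuth_equiv_len (k : nat) (w w' : word) : Prop :=
  exists (r : nat) (ws : nat -> word),
    [/\ ws 0 = w, ws r = w',
        forall i, i < r -> KKnuth_move (ws i) (ws i.+1)
      & forall i, i <= r -> size (ws i) <= k].

(* Main.v *)
(* By induction on [w] it suffices to treat one insertion, and there one row at
   a time: writing [y] for the value bumped out of row [R] by [x] and [R'] for
   the resulting row, the word [.. R x Q ..] ([Q] the row above) reduces to
   [.. y R' Q ..] without ever exceeding its length.  When [R] can be modified,
   or when it already contains [x], this is the usual computation inside the
   word [R x].  Otherwise the obstruction comes from [Q]: since [x] was bumped
   out of [Q], a failure forces [x] to sit in [Q] exactly above the position
   it wants in [R].  In that case the columns to the left of that position are
   read one by one, and everything boils down to the identity
   [b a y x a = y b a y x] for [a < b < x < y] (lemma [kred_core]). *)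
Require Import Defs.
From mathcomp Require Import all_boot zify.

Set Implicit Arguments.
Unset Strict Implicit.
Unset Printing Implicit Defensive.

(** * Reductions: chains of moves never longer than their first word *)

(* A preorder compatible with concatenation; it is symmetric only between words
   of the same length (lemma [kred_sym]). *)
Definition kred (u v : word) : Prop := KKnuth_equiv_len (size u) u v.

Lemma KKnuth_equiv_len_refl k w : size w <= k -> KKnuth_equiv_len k w w.
Proof. by move=> le_wk; exists 0, (fun=> w); split. Qed.

Lemma KKnuth_equiv_len_trans k u v w :
  KKnuth_equiv_len k u v -> KKnuth_equiv_len k v w -> KKnuth_equiv_len k u w.
Proof.
case=> r [f [f0 fr fS fk]] [s [g [g0 gs gS gk]]].
exists (r + s), (fun i => if i < r then f i else g (i - r)); split.
- by case: r fr {fS fk} => [|r] fr //; rewrite g0 -fr f0.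
- by rewrite ltnNge leq_addr addKn.
- move=> i lt_i; have [lt_ir|le_ri] := ltnP i r.
    have [lt_iSr|le_rSi] := ltnP i.+1 r; first exact: fS.
    (* The junction [i.+1 = r]: the target is [g 0 = v = f r], so this move is still the last one of
       [f]. *)
    have -> : i.+1 - r = 0 by lia.
    have eq_r : r = i.+1 by lia.
    by rewrite g0 -fr {1}eq_r; apply: fS.
  rewrite ltnNge leqW //= subSn //; apply: gS; lia.
- move=> i le_i; case: ltnP => lt_ir; first by apply: fk; lia.
  apply: gk; lia.
Qed.

Lemma KKnuth_move_sym w w' : KKnuth_move w w' -> KKnuth_move w' w.
Proof.
by case=> a [u [v [b [uv -> ->]]]]; exists a, v, u, b; split=> //; case: uv; auto.
Qed.

Lemma KKnuth_equiv_len_sym k u v :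
  KKnuth_equiv_len k u v -> KKnuth_equiv_len k v u.
Proof.
case=> r [f [f0 fr fS fk]]; exists r, (fun i => f (r - i)); split.
- by rewrite subn0.
- by rewrite subnn.
- move=> i lt_ir; apply: KKnuth_move_sym.
  have -> : r - i = (r - i.+1).+1 by lia.
  apply: fS; lia.
- move=> i _; apply: fk; lia.
Qed.

Lemma KKnuth_equiv_len_leq k l u v :
  k <= l -> KKnuth_equiv_len k u v -> KKnuth_equiv_len l u v.
Proof.
move=> le_kl [r [f [f0 fr fS fk]]]; exists r, f; split=> // i /fk le_fi.
exact: leq_trans le_fi le_kl.
Qed.

Lemma KKnuth_equiv_len_ctx k a b u v :
  KKnuth_equiv_len k u v ->
  KKnuth_equiv_len (size a + k + size b) (a ++ u ++ b) (a ++ v ++ b).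
Proof.
case=> r [f [f0 fr fS fk]]; exists r, (fun i => a ++ f i ++ b).
rewrite f0 fr; split=> // i lt_ir.
  have [c [s [t [d [st -> ->]]]]] := fS i lt_ir.
  by exists (a ++ c), s, t, (d ++ b); split=> //; rewrite -!catA.
by rewrite !size_cat addnA leq_add2r leq_add2l fk.
Qed.

Lemma kred_refl w : kred w w.
Proof. exact: KKnuth_equiv_len_refl. Qed.

Lemma kred_size u v : kred u v -> size v <= size u.
Proof. by case=> r [f [_ <- _ fk]]; apply: fk. Qed.

Lemma kred_trans v u w : kred u v -> kred v w -> kred u w.
Proof.
move=> uv vw; apply: (KKnuth_equiv_len_trans uv).
exact: KKnuth_equiv_len_leq (kred_size uv) vw.
Qed.

(** Equal lengths give both chains the same bound, so the second can be run backwards. This is how a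
    detour through a shorter common word is allowed. *)
Lemma kred_join w u v : size u = size v -> kred u w -> kred v w -> kred u v.
Proof.
move=> eq_uv uw vw; apply: (KKnuth_equiv_len_trans uw).
by rewrite eq_uv; apply: KKnuth_equiv_len_sym.
Qed.

Lemma kred_sym u v : size u = size v -> kred u v -> kred v u.
Proof. by move=> eq_uv; apply: kred_join (kred_refl _). Qed.

Lemma kred_ctx a b u v : kred u v -> kred (a ++ u ++ b) (a ++ v ++ b).
Proof.
by move=> uv; rewrite /kred !size_cat addnA; apply: KKnuth_equiv_len_ctx.
Qed.

Lemma kred_catl a u v : kred u v -> kred (a ++ u) (a ++ v).
Proof. by move/(kred_ctx a [::]); rewrite !cats0. Qed.

Lemma kred_catr b u v : kred u v -> kred (u ++ b) (v ++ b).
Proof. exact: (kred_ctx [::]). Qed.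

Lemma kred_cons x u v : kred u v -> kred (x :: u) (x :: v).
Proof. exact: (kred_catl [:: x]). Qed.

(** The size condition lets [KKnuth_idem] act only as the contraction of [xx] to [x]. *)
Lemma kred_rule u v b :
  KKnuth_rule u v \/ KKnuth_rule v u -> size v <= size u ->
  kred (u ++ b) (v ++ b).
Proof.
move=> uv le_vu; apply: kred_catr.
exists 1, (fun i => if i is 0 then u else v); split=> //; last by case.
by case=> // _; exists [::], u, v, [::]; rewrite /= !cats0; split.
Qed.

Lemma kred_xzy x y z b : x < y < z -> kred [:: x, z, y & b] [:: z, x, y & b].
Proof.
case/andP=> xy yz; apply: (@kred_rule [:: x; z; y] [:: z; x; y]) => //.
by left; constructor.
Qed.

Lemma kred_zxy x y z b : x < y < z -> kred [:: z, x, y & b] [:: x, z, y & b].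
Proof. by move=> xyz; apply: kred_sym => //; apply: kred_xzy. Qed.

Lemma kred_yxz x y z b : x < y < z -> kred [:: y, x, z & b] [:: y, z, x & b].
Proof.
case/andP=> xy yz; apply: (@kred_rule [:: y; x; z] [:: y; z; x]) => //.
by left; constructor.
Qed.

Lemma kred_yzx x y z b : x < y < z -> kred [:: y, z, x & b] [:: y, x, z & b].
Proof. by move=> xyz; apply: kred_sym => //; apply: kred_yxz. Qed.

Lemma kred_idem x b : kred [:: x, x & b] (x :: b).
Proof. by apply: (@kred_rule [:: x; x] [:: x]) => //; right; constructor. Qed.

Lemma kred_braid x y b : kred [:: x, y, x & b] [:: y, x, y & b].
Proof.
by apply: (@kred_rule [:: x; y; x] [:: y; x; y]) => //; left; constructor.
Qed.

(** * Bumping inside a single increasing row *)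

Lemma sorted_ltn_rcons A x :
  sorted ltn (rcons A x) = sorted ltn A && all (ltn^~ x) A.
Proof.
rewrite !(sorted_pairwise ltn_trans) -cats1 pairwise_cat allrel1r /= andbT.
exact: andbC.
Qed.

(** Starting from the right end of [B], [x] jumps over each letter by [yzx = yxz]; the letter just
    before the one crossed serves as the middle value. *)
Lemma kred_small_left x y B S :
  x < y -> path ltn y B -> kred (y :: B ++ x :: S) [:: y, x & B ++ S].
Proof.
elim: B y => [|z B IH] y xy /=; first by move=> _; apply: kred_refl.
case/andP=> yz zB; apply: (@kred_trans [:: y, z, x & B ++ S]).
  by apply: kred_cons; apply: IH => //; lia.
by apply: kred_yzx; rewrite xy.
Qed.

(** Here [y] crosses each letter of [A] by [xzy = zxy]; the middle value is the letter that follows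
    the one crossed, and [h] plays this part for the last letter of [A]. *)
Lemma kred_large_left y h A S :
  h < y -> sorted ltn (rcons A h) ->
  kred (A ++ [:: y, h & S]) (y :: A ++ h :: S).
Proof.
move=> hy; elim: A => [|a A IH] /= aA; first exact: kred_refl.
apply: (@kred_trans (a :: y :: A ++ h :: S)).
  by apply/kred_cons/IH; apply: path_sorted aA.
have ltA : all (ltn^~ y) (rcons A h).
  move: (path_sorted aA); rewrite sorted_ltn_rcons all_rcons /= hy => /andP[_].
  by apply: sub_all => z /= zh; apply: ltn_trans hy.
case: A aA ltA {IH} => [|b A] /= /andP[ab _].
  by rewrite andbT => _; apply: kred_xzy; rewrite ab.
by case/andP=> by_ _; apply: kred_xzy; rewrite ab.
Qed.

Lemma kred_bump A x y B S :
  x < y -> sorted ltn (rcons A x) -> path ltn y B ->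
  kred (A ++ y :: B ++ x :: S) (y :: A ++ x :: B ++ S).
Proof.
move=> xy Ax yB; refine (kred_trans _ (kred_large_left _ xy Ax)).
by apply: kred_catl; apply: kred_small_left.
Qed.

(** Once [x] has come back to [y], the braid [xyx = yxy] creates a second [y]: one copy stays in the
    row, the other is bumped out. *)
Lemma kred_bump_fixed A x y B S :
  x < y -> sorted ltn (rcons A x) -> path ltn y B ->
  kred (A ++ [:: x, y & B ++ x :: S]) (y :: A ++ [:: x, y & B ++ S]).
Proof.
move=> xy Ax yB; refine (kred_trans _ (kred_large_left _ xy Ax)).
apply: kred_catl; apply: (@kred_trans [:: x, y, x & B ++ S]).
  by apply: kred_cons; apply: kred_small_left.
exact: kred_braid.
Qed.

(** * Words of two consecutive rows, read by columns *)

(* A pair [(b, a)] is a column of two rows, [a] above [b]. *)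
Definition columns (s : seq (nat * nat)) : word :=
  flatten [seq [:: p.1; p.2] | p <- s].

(** Each upper entry travels left through the lower row until it meets the entry below it. No letter
    is lost, so the reduction is reversible. *)
Lemma kred_columns s D S :
  all (fun p => p.2 < p.1) s -> sorted ltn (unzip1 s ++ D) ->
  kred (unzip1 s ++ D ++ unzip2 s ++ S) (columns s ++ D ++ S).
Proof.
elim: s => [|[b a] s IH] /=; first by move=> *; apply: kred_refl.
case/andP=> ab s_ok bs.
apply: (@kred_trans [:: b, a & (unzip1 s ++ D) ++ unzip2 s ++ S]).
  by rewrite catA; apply: kred_small_left.
by rewrite -catA; do 2!apply: kred_cons; apply: IH => //; apply: path_sorted bs.
Qed.

Lemma size_columns s : size (columns s) = size (unzip1 s) + size (unzip2 s).
Proof. by rewrite !size_map; elim: s => //= p s ->; lia. Qed.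

Lemma columns_cat s t : columns (s ++ t) = columns s ++ columns t.
Proof. by rewrite /columns map_cat flatten_cat. Qed.

Definition lt_pair (p q : nat * nat) := (p.1 < q.1) && (p.2 < q.2).

(** To cross a column [d c], [y] borrows the next column [b' a']: [y d c b' a'], [y d b' c a'],
    [d y b' c a'], [d y c b' a'], [d c y b' a']. The final column [b a] is kept as the one to
    borrow. *)
Lemma kred_past_columns y s b a S :
  b < y -> all (fun p => p.2 < p.1) (rcons s (b, a)) ->
  sorted lt_pair (rcons s (b, a)) ->
  kred (y :: columns s ++ [:: b, a & S]) (columns s ++ [:: y, b, a & S]).
Proof.
move=> b_y; elim: s => [|[d c] s IH] /=; first by move=> *; apply: kred_refl.
case/andP=> cd s_ok ds; have s_inc := path_sorted ds.
apply: (@kred_trans [:: d, c, y & columns s ++ [:: b, a & S]]); last first.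
  by do 2!apply: kred_cons; apply: IH.
clear IH; have : all (fun p => p.1 < y) (rcons s (b, a)).
  elim: s s_inc {ds s_ok} => [|p s IH] /=; first by rewrite b_y.
  move=> ps; have := IH (path_sorted ps).
  by case: s ps {IH} => [|q s] /= /andP[/andP[pq _] _] /andP[qy s_y];
    rewrite ?s_y qy andbT /= (ltn_trans pq).
move=> lt_sy.
have [b' [a' [w [-> db' ca' a'b' b'y]]]] : exists b' a' w,
    [/\ columns s ++ [:: b, a & S] = [:: b', a' & w],
        d < b', c < a', a' < b' & b' < y].
  case: s ds s_ok lt_sy {s_inc} => [|[b' a'] s] /= /andP[/andP[/= db' ca'] _].
    by case/andP=> ab _ _; exists b, a, S.
  by case/andP=> a'b' _ /andP[b'y _]; exists b', a', (columns s ++ [:: b, a & S]).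
apply: (@kred_trans [:: y, d, b', c, a' & w]).
  by apply/kred_cons/kred_yxz; rewrite cd.
apply: (@kred_trans [:: d, y, b', c, a' & w]).
  by apply: kred_zxy; rewrite db'.
apply: (@kred_trans [:: d, y, c, b', a' & w]).
  by do 2!apply: kred_cons; apply: kred_zxy; rewrite ca'.
by apply: kred_yzx; lia.
Qed.

(* Both sides reduce to [y b x a]. *)
Lemma kred_core a b x y S :
  a < b -> b < x -> x < y ->
  kred [:: b, a, y, x, a & S] [:: y, b, a, y, x & S].
Proof.
move=> ab bx xy; apply: (@kred_join [:: y, b, x, a & S]) => //.
  apply: (@kred_trans [:: b, y, a, x, a & S]); first by apply: kred_yxz; lia.
  apply: (@kred_trans [:: b, y, x, a, x & S]).
    by do 2!apply: kred_cons; apply: kred_braid.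
  apply: (@kred_trans [:: y, b, x, a, x & S]); first by apply: kred_xzy; lia.
  apply: (@kred_trans [:: y, b, a, x, a & S]).
    by do 2!apply: kred_cons; apply: kred_braid.
  apply: (@kred_trans [:: y, b, x, a, a & S]).
    by apply: kred_cons; apply: kred_yxz; lia.
  by do 3!apply: kred_cons; apply: kred_idem.
apply: (@kred_trans [:: y, b, y, a, x & S]).
  by apply: kred_cons; apply: kred_yxz; lia.
apply: (@kred_trans [:: b, y, b, a, x & S]); first exact: kred_braid.
apply: (@kred_trans [:: b, y, b, x, a & S]).
  by do 2!apply: kred_cons; apply: kred_yxz; lia.
apply: (@kred_trans [:: y, b, y, x, a & S]); first exact: kred_braid.
apply: (@kred_trans [:: y, y, b, x, a & S]).
  by apply: kred_cons; apply: kred_xzy; lia.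
exact: kred_idem.
Qed.

Lemma sorted_lt_pair s :
  sorted ltn (unzip1 s) -> sorted ltn (unzip2 s) -> sorted lt_pair s.
Proof.
elim: s => [|p [|q s] IH] //= /andP[pq1 s1] /andP[pq2 s2].
by rewrite {1}/lt_pair pq1 pq2 /=; apply: IH.
Qed.

(** The upper row has [x] directly above [y], so [y] cannot be replaced. The pairs in [s] are the
    columns to the left of that position. *)
Lemma kred_blocked_bump s x y B S :
  all (fun p => p.2 < p.1) s -> sorted ltn (rcons (unzip1 s) x) ->
  sorted ltn (unzip1 s ++ y :: B) -> sorted ltn (rcons (unzip2 s) x) ->
  x < y ->
  kred (unzip1 s ++ y :: B ++ x :: unzip2 s ++ x :: S)
       (y :: unzip1 s ++ y :: B ++ unzip2 s ++ x :: S).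
Proof.
move=> s_ok s1x s1yB s2x xy; have [_ /= yB] := cat_sorted2 s1yB.
(* With no column to the left, each side contains a repeated letter and both contract to the same
   word. Otherwise the nearest column [(b, a)] supplies the two extra letters of [kred_core]. *)
case/lastP: s => [|s [b a]] in s_ok s1x s1yB s2x *.
  apply: (@kred_join (y :: B ++ x :: S)) => /=.
  - by rewrite !size_cat /=; lia.
  - by apply/kred_cons/kred_catl/kred_idem.
  - exact: kred_idem.
move: s1x s1yB s2x.
rewrite /unzip1 /unzip2 !map_rcons -!/(unzip1 _) -!/(unzip2 _) /=.
move=> s1x s1yB s2x.
have bx : b < x.
  by move: s1x; rewrite -!cats1 -catA => /cat_sorted2[_ /=]; rewrite andbT.
have ax : a < x.
  by move: s2x; rewrite -!cats1 -catA => /cat_sorted2[_ /=]; rewrite andbT.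
have ab : a < b by move: s_ok; rewrite all_rcons => /andP[].
have s1 : sorted ltn (rcons (unzip1 s) b).
  by move: s1x; rewrite -(cats1 _ x) => /cat_sorted2[].
have s2 : sorted ltn (rcons (unzip2 s) a).
  by move: s2x; rewrite -(cats1 _ x) => /cat_sorted2[].
have s_inc : sorted lt_pair (rcons s (b, a)).
  by apply: sorted_lt_pair; rewrite /unzip1 /unzip2 map_rcons.
have xB : path ltn x B by apply: path_le yB => // ? ? ?; apply: ltn_trans.
set c := columns s.
have cols D w : sorted ltn (rcons (unzip1 s) b ++ D) ->
    kred (rcons (unzip1 s) b ++ D ++ rcons (unzip2 s) a ++ w)
         (c ++ [:: b, a & D ++ w]).
  have := @kred_columns (rcons s (b, a)) D w s_ok.
  rewrite /unzip1 /unzip2 !map_rcons -!/(unzip1 _) -!/(unzip2 _) /=.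
  by rewrite -(cats1 s) columns_cat -catA.
have cols_size D w : size (c ++ [:: b, a & D ++ w]) =
    size (rcons (unzip1 s) b ++ D ++ rcons (unzip2 s) a ++ w).
  by rewrite !size_cat /= !size_cat !size_rcons size_columns; lia.
(* Both sides reduce to [c ++ [:: y, b, a, y, x & B ++ S]]: on the left, the
   inserted [x] first bumps [a] out of the upper row. *)
apply: (@kred_trans (rcons (unzip1 s) b ++ (y :: B) ++
    rcons (unzip2 s) a ++ [:: x, a & S])).
  rewrite /=; do 2!(apply: kred_catl => //=; try apply: kred_cons).
  rewrite -!cats1 -!catA /=.
  apply: (@kred_trans (unzip2 s ++ [:: x, a, x & S])).
    apply: kred_sym; first by rewrite /= !size_cat /=; lia.
    exact: kred_large_left.
  by apply: kred_catl; apply: kred_braid.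
apply: (kred_trans (cols _ _ s1yB)).
apply: (@kred_trans (c ++ [:: b, a, y, x, a & B ++ S])).
  apply: kred_catl; do 2!apply: kred_cons; rewrite /=.
  apply: (@kred_trans [:: y, x & B ++ a :: S]); first exact: kred_small_left.
  by apply: kred_cons; apply: kred_small_left.
apply: (@kred_trans (c ++ [:: y, b, a, y, x & B ++ S])).
  by apply: kred_catl; apply: kred_core.
(* From here the rearrangements are undone: [y] returns to the front, [x] goes back behind [B], and
   the columns become rows again. *)
apply: (@kred_trans (y :: c ++ [:: b, a, y, x & B ++ S])).
  apply: kred_sym; first by rewrite /= !size_cat /=; lia.
  by apply: kred_past_columns => //; apply: ltn_trans xy.
apply: kred_cons.
apply: (@kred_trans (c ++ [:: b, a & (y :: B) ++ x :: S])).
  apply: kred_catl; do 2!apply: kred_cons.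
  apply: kred_sym; first by rewrite /= !size_cat /=; lia.
  exact: kred_small_left.
by apply: kred_sym; [rewrite cols_size | apply: (cols (y :: B) (x :: S))].
Qed.

(** Reading the columns first makes the two copies of [x] adjacent; they contract, and the column
    reading is then undone. *)
Lemma kred_blocked_append s x S :
  all (fun p => p.2 < p.1) s -> sorted ltn (rcons (unzip1 s) x) ->
  kred (unzip1 s ++ x :: unzip2 s ++ x :: S) (unzip1 s ++ unzip2 s ++ x :: S).
Proof.
move=> s_ok s1x.
have s1 : sorted ltn (unzip1 s ++ [::]).
  by move: s1x; rewrite -cats1 cats0 => /cat_sorted2[].
rewrite -cats1 in s1x.
apply: (kred_trans (@kred_columns s [:: x] (x :: S) s_ok s1x)).
apply: (@kred_trans (columns s ++ x :: S)).
  by apply: kred_catl; apply: kred_idem.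
apply: kred_sym; last exact: (@kred_columns s [::]).
by rewrite !size_cat size_columns; lia.
Qed.

(** * Increasing tableaux as conditions on consecutive rows *)

Definition row_ok (R : seq nat) : bool :=
  [&& 0 < size R, positive_word R & sorted ltn R].

Definition lies_above (Q R : seq nat) : bool :=
  (size R <= size Q) && all (fun j => nth 0 Q j < nth 0 R j) (iota 0 (size R)).

Lemma lies_aboveP Q R :
  reflect (size R <= size Q /\ forall j, j < size R -> nth 0 Q j < nth 0 R j)
          (lies_above Q R).
Proof.
apply: (iffP andP) => -[le_RQ QR]; split=> //.
  by move=> j jR; apply: (allP QR); rewrite mem_iota.
by apply/allP=> j; rewrite mem_iota => /QR.
Qed.

Lemma column_cons Q T j :
  column (Q :: T) j =
  if j < size Q then nth 0 Q j :: column T j else column T j.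
Proof. by rewrite /column /=; case: ifP. Qed.

Lemma column_out R T j :
  sorted geq (map size (R :: T)) -> size R <= j -> column (R :: T) j = [::].
Proof.
move=> szT Rj; rewrite /column (eq_in_filter (a2 := pred0)) ?filter_pred0 //.
have geq_trans : transitive geq by move=> m n p nm pm; apply: leq_trans pm nm.
move=> P; rewrite inE => /predU1P[-> | PT]; first by rewrite ltnNge Rj.
have /allP/(_ (size P)) := order_path_min geq_trans szT.
by rewrite map_f // => /(_ isT) PR; rewrite ltnNge (leq_trans PR).
Qed.

(** Putting [Q] on top adds one entry to each column, so the only new vertical condition compares
    [Q] with the next row. *)
Lemma increasing_tableau_cons Q T :
  increasing_tableau (Q :: T) =
  [&& row_ok Q, increasing_tableau T
    & if T is R :: _ then lies_above Q R else true].
Proof.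
case: T => [|R T].
  rewrite /increasing_tableau /straight_shape /row_ok /= !andbT.
  rewrite [all _ (iota _ _)](_ : _ = true) ?andbT //.
  by apply/allP=> j _; rewrite column_cons; case: ifP.
have cols : sorted geq (map size (R :: T)) -> size R <= size Q ->
    all (fun j => sorted ltn (column [:: Q, R & T] j)) (iota 0 (size Q)) =
    all (fun j => sorted ltn (column (R :: T) j)) (iota 0 (size R)) &&
    all (fun j => nth 0 Q j < nth 0 R j) (iota 0 (size R)).
  (* The column indices are cut at [size R]: beyond it the columns of [R :: T] are empty and nothing
     remains to compare. *)
  move=> szT RQ; rewrite -all_predI -(subnKC RQ) iotaD all_cat add0n andbC.
  rewrite [all _ (iota (size R) _)](_ : _ = true) /=.
    apply: eq_in_all => j; rewrite mem_iota /= => jR.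
    by rewrite !column_cons (leq_trans jR RQ) jR /= andbC.
  apply/allP=> j; rewrite mem_iota => /andP[Rj _].
  by rewrite column_cons column_out //; case: ifP.
rewrite /increasing_tableau /straight_shape /row_ok /lies_above.
rewrite [head _ _]/= [head _ (R :: T)]/=.
have [RQ|] := boolP (size R <= size Q); last first.
  by move=> nRQ; rewrite /= (negPf nRQ) /= !andbF.
have [szT|nszT] := boolP (sorted geq (map size (R :: T))); last first.
  have -> : sorted geq (map size [:: Q, R & T]) = false.
    by rewrite /= in nszT *; rewrite (negPf nszT) andbF.
  by rewrite /= !andbF.
rewrite cols //.
have -> : sorted geq (map size [:: Q, R & T]).
  by rewrite /= in szT *; rewrite szT andbT.
have reorder a b c a' b' c' d e :
    [&& true && (a && a'), b && b', c && c' & d && e] =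
    [&& [&& a, b & c], [&& true && a', b', c' & d] & true && e].
  by case: a b c a' b' c' d e => [] [] [] [] [] [] [] [].
exact: (reorder (0 < size Q) (positive_word Q) (sorted ltn Q)
  (all (leq 1) (map size (R :: T))) (all positive_word (R :: T))
  (all (sorted ltn) (R :: T))).
Qed.

(** The case of no row above is separate because the default row of [last] is empty, and no nonempty
    row lies below an empty one. *)
Definition fits_below (above : filling) (R : seq nat) : bool :=
  (above == [::]) || lies_above (last [::] above) R.

(** This localizes the test on the whole tableau made by insertion: changing [R] affects only [R]
    itself and its two neighbours. *)
Lemma increasing_tableau_cat above R rest :
  increasing_tableau (above ++ R :: rest) =
  [&& increasing_tableau above, increasing_tableau (R :: rest)
    & fits_below above R].
Proof.
rewrite /fits_below.
elim: above => [|Q above IH]; first by rewrite /= andbT.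
rewrite cat_cons increasing_tableau_cons IH (increasing_tableau_cons Q above).
case: above {IH} => [|P above].
  by rewrite [increasing_tableau [::]]/= !andbT.
rewrite [last _ _]/= [_ == [::]]/= [_ == [::]]/= /=.
case: (row_ok Q) => //=; case: (increasing_tableau (P :: above)) => //=.
by case: (lies_above Q P); rewrite /= ?andbT ?andbF.
Qed.

(** * Splitting a row at the insertion position, reading words, vertical comparisons *)

Lemma sorted_ltn_cat A y B :
  sorted ltn (A ++ y :: B) =
  [&& sorted ltn A, all (ltn^~ y) A & path ltn y B].
Proof.
rewrite -cat_rcons; case: A => [|a A] //=.
rewrite cat_path last_rcons.
rewrite -[path ltn a (rcons A y)]/(sorted ltn (rcons (a :: A) y)).
by rewrite sorted_ltn_rcons /= -!andbA.
Qed.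

(** Only the last entry can equal [x]. This separates an obstruction inside the row from one caused
    by the row above. *)
Lemma sorted_ltn_leP A x :
  sorted ltn A -> all (leq^~ x) A ->
  all (ltn^~ x) A \/ exists A0, A = rcons A0 x.
Proof.
case/lastP: A => [|A z]; first by left.
rewrite sorted_ltn_rcons !all_rcons => /andP[_ Az] /andP[].
rewrite leq_eqVlt => /predU1P[->|zx] _; first by right; exists A.
left; apply/andP; split=> //; apply: sub_all Az => t tz; exact: ltn_trans tz zx.
Qed.

(** Strictness makes [y] occur only once, so [replace], which acts on every occurrence, changes a
    single box. *)
Lemma bumpedP x R :
  sorted ltn R -> ~~ all (leq^~ x) R ->
  exists A y B, [/\ R = A ++ y :: B, all (leq^~ x) A, x < y,
    bumped x R = y & replace y x R = A ++ x :: B].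
Proof.
elim: R => [|z R IH] //= zR; case: (leqP z x) => [zx|xz] /= nR; last first.
  exists [::], z, R; split=> //; first by rewrite /bumped /= xz.
  rewrite /replace /= eqxx; congr (_ :: _); rewrite -[RHS]map_id.
  apply/eq_in_map => t tR; case: eqP => // tz.
  by have /allP/(_ t tR) := order_path_min ltn_trans zR; rewrite tz ltnn.
have [A [y [B [-> xA xy bR rR]]]] := IH (path_sorted zR) nR.
exists (z :: A), y, B; split=> //=; first by rewrite zx.
  by rewrite -[RHS]bR /bumped /= [x < z]ltnNge zx.
by rewrite -rR /replace /= ltn_eqF ?(leq_ltn_trans zx).
Qed.

Lemma row_word_cat above below :
  row_word (above ++ below) = row_word below ++ row_word above.
Proof. by rewrite /row_word rev_cat flatten_cat. Qed.

Lemma row_word_cons R T : row_word (R :: T) = row_word T ++ R.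
Proof. by rewrite /row_word rev_cons flatten_rcons. Qed.

Lemma row_word_rcons T R : row_word (rcons T R) = R ++ row_word T.
Proof. by rewrite /row_word rev_rcons. Qed.

Lemma lies_above_catl Q A C : lies_above Q (A ++ C) -> lies_above Q A.
Proof.
case/lies_aboveP; rewrite size_cat => szQ ltQ.
apply/lies_aboveP; split=> [|j jA]; first by lia.
by have := ltQ j; rewrite nth_cat jA ltn_addr //; apply.
Qed.

Lemma lies_above_rcons Q A x :
  lies_above Q A -> size A < size Q -> nth 0 Q (size A) < x ->
  lies_above Q (rcons A x).
Proof.
case/lies_aboveP=> _ ltQ AQ Qx; apply/lies_aboveP.
rewrite size_rcons; split=> // j; rewrite nth_rcons ltnS leq_eqVlt.
by case/predU1P=> [->|jA]; rewrite ?ltnn ?eqxx // jA ltQ.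
Qed.

Lemma lies_above_replace Q A x y B :
  lies_above Q (A ++ y :: B) -> nth 0 Q (size A) < x ->
  lies_above Q (A ++ x :: B).
Proof.
case/lies_aboveP=> szQ ltQ Qx; apply/lies_aboveP; split.
  by move: szQ; rewrite !size_cat.
move=> j; have := ltQ j; rewrite !size_cat !nth_cat /=.
case: (ltnP j (size A)) => // Aj; have [->|jA] := eqVneq j (size A).
  by rewrite subnn /= Qx.
by have -> : j - size A = (j - size A).-1.+1 by lia.
Qed.

Lemma lies_above_lower A x y B R :
  x < y -> lies_above (A ++ y :: B) R -> lies_above (A ++ x :: B) R.
Proof.
move=> xy /lies_aboveP[szR ltR]; apply/lies_aboveP; split.
  by move: szR; rewrite !size_cat.
move=> j jR; apply: leq_ltn_trans (ltR j jR); rewrite !nth_cat.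
by case: (ltnP j (size A)) => // _; case: (j - size A) => //=; apply: ltnW.
Qed.

Lemma lies_above_extend Q x R : lies_above Q R -> lies_above (rcons Q x) R.
Proof.
case/lies_aboveP=> szR ltR; apply/lies_aboveP; rewrite size_rcons.
split=> [|j jR]; first exact: leqW.
by rewrite nth_rcons (leq_trans jR szR) ltR.
Qed.

(** * Failed modifications and the row above *)

(* What Hecke insertion guarantees about a value [x] bumped out of the last row
   of [above], replaced there or not, when it is inserted into the row [R]. *)
Definition bump_context (above : filling) (R : seq nat) (x : nat) : Prop :=
  above = [::] \/
  exists c, [/\ c < size (last [::] above), nth 0 (last [::] above) c <= x
              & c < size R -> x < nth 0 R c].

(** Bumping paths move weakly left: were [c] a position of [A], the entry of the row at [c] would be
    at most [x], against the context. Hence the row above has a box over the insertion position,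
    with entry at most [x]. *)
Lemma bump_context_nth above A C x :
  bump_context above (A ++ C) x -> all (leq^~ x) A ->
  above = [::] \/ size A < size (last [::] above) /\
    (sorted ltn (last [::] above) -> nth 0 (last [::] above) (size A) <= x).
Proof.
case=> [->|[c [cQ Qc Rc]] Ax]; [by left | right].
have Ac : size A <= c.
  rewrite leqNgt; apply/negP=> cA; have : c < size (A ++ C).
    by rewrite size_cat ltn_addr.
  by move/Rc; rewrite nth_cat cA ltnNge (allP Ax) ?mem_nth.
split=> [|Q_inc]; first exact: leq_ltn_trans cQ.
move: Ac; rewrite leq_eqVlt => /predU1P[-> //|Ac].
by apply: ltnW; apply: leq_trans Qc; apply: (sorted_ltn_nth ltn_trans) => //;
   rewrite inE ?(ltn_trans Ac).
Qed.

Lemma blocked_decomposition Q A x :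
  lies_above Q A -> size A < size Q -> nth 0 Q (size A) = x ->
  exists s S, [/\ A = unzip1 s, Q = unzip2 s ++ x :: S
                & all (fun p => p.2 < p.1) s].
Proof.
case/lies_aboveP=> _ ltQ AQ Qx; set Q1 := take (size A) Q.
have szQ1 : size Q1 = size A by rewrite size_takel // ltnW.
exists (zip A Q1), (drop (size A).+1 Q).
rewrite unzip1_zip ?unzip2_zip ?szQ1 //; split=> //.
  by rewrite -Qx -drop_nth // cat_take_drop.
apply/(all_nthP (0, 0)) => j; rewrite size_zip szQ1 minnn => jA.
by rewrite nth_zip ?szQ1 //= nth_take // ltQ.
Qed.

Lemma increasing_row T R : increasing_tableau T -> R \in T -> sorted ltn R.
Proof. by case/and4P=> _ _ /allP T_inc _ /T_inc. Qed.

(** The entry over the insertion position is at most [x] by the context and not smaller by the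
    obstruction, so it equals [x]. The word [S] collects the rest of that row and all higher
    rows. *)
Lemma blocked_above above A x :
  increasing_tableau above -> fits_below above A ->
  (above = [::] \/ size A < size (last [::] above) /\
    (sorted ltn (last [::] above) -> nth 0 (last [::] above) (size A) <= x)) ->
  ~~ ((above == [::]) || (nth 0 (last [::] above) (size A) < x)) ->
  exists s S, [/\ A = unzip1 s, row_word above = unzip2 s ++ x :: S,
    all (fun p => p.2 < p.1) s & sorted ltn (rcons (unzip2 s) x)].
Proof.
case/lastP: above => [|above Q] //.
rewrite /fits_below -size_eq0 size_rcons last_rcons /= -leqNgt.
move=> T_inc QA [/(congr1 size)|[AQ Qx] xQ]; first by rewrite size_rcons.
have Q_inc : sorted ltn Q.
  by apply: increasing_row T_inc _; rewrite mem_rcons mem_head.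
have {xQ} Qx' : nth 0 Q (size A) = x by apply/anti_leq; rewrite xQ Qx.
have [s [S [-> defQ s_ok]]] := blocked_decomposition QA AQ Qx'.
exists s, (S ++ row_word above); split=> //.
  by rewrite row_word_rcons defQ -catA.
by move: Q_inc; rewrite defQ -cat_rcons => /cat_sorted2[].
Qed.

(** Either [A] already ends in [x] and the two copies contract, or [x] sits just above the new box
    and [kred_blocked_append] applies. *)
Lemma kred_append_fails above A x :
  increasing_tableau above -> fits_below above A -> bump_context above A x ->
  sorted ltn A -> all (leq^~ x) A ->
  ~~ (all (ltn^~ x) A && fits_below above (rcons A x)) ->
  kred (A ++ x :: row_word above) (A ++ row_word above).
Proof.
move=> T_inc QA ctx A_inc Ax.
have [Ax'|[A0 ->] _] := sorted_ltn_leP A_inc Ax; last first.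
  by rewrite cat_rcons -cats1 -catA; apply/kred_catl/kred_idem.
rewrite -(cats0 A) in ctx; have Q_ctx := bump_context_nth ctx Ax.
rewrite Ax' /= => blocked.
have [|s [S [defA -> s_ok s2x]]] := blocked_above T_inc QA Q_ctx.
  apply: contra blocked => /orP[|Qx]; first by rewrite /fits_below => ->.
  case: Q_ctx => [->|[AQ _]]; first by [].
  case/orP: QA => [|QA]; first by rewrite /fits_below => ->.
  by rewrite /fits_below lies_above_rcons ?orbT.
by rewrite defA; apply: kred_blocked_append; rewrite // -defA sorted_ltn_rcons A_inc.
Qed.

(** The same dichotomy: [x] just before [y] in the row leads to [kred_bump_fixed], and [x] just
    above [y] to [kred_blocked_bump]. *)
Lemma kred_replace_fails above A x y B :
  increasing_tableau above -> fits_below above (A ++ y :: B) ->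
  bump_context above (A ++ y :: B) x ->
  sorted ltn (A ++ y :: B) -> all (leq^~ x) A -> x < y ->
  ~~ (all (ltn^~ x) A && fits_below above (A ++ x :: B)) ->
  kred ((A ++ y :: B) ++ x :: row_word above)
       (y :: (A ++ y :: B) ++ row_word above).
Proof.
move=> T_inc QR ctx R_inc Ax xy.
have [A_inc Ay yB] : [/\ sorted ltn A, all (ltn^~ y) A & path ltn y B].
  by apply/and3P; rewrite -sorted_ltn_cat.
have [Ax'|[A0 defA] _] := sorted_ltn_leP A_inc Ax; last first.
  by rewrite defA in A_inc *; rewrite !cat_rcons -!catA /=; apply: kred_bump_fixed.
have Q_ctx := bump_context_nth ctx Ax.
have QA : fits_below above A.
  by rewrite /fits_below; case/orP: QR => [->|/lies_above_catl ->]; rewrite ?orbT.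
rewrite Ax' /= => blocked.
have [|s [S [defA -> s_ok s2x]]] := blocked_above T_inc QA Q_ctx.
  apply: contra blocked => /orP[|Qx]; first by rewrite /fits_below => ->.
  case/orP: QR => [|QR]; first by rewrite /fits_below => ->.
  by rewrite /fits_below (lies_above_replace QR) ?orbT.
have s1x : sorted ltn (rcons (unzip1 s) x) by rewrite -defA sorted_ltn_rcons A_inc.
by rewrite defA in R_inc *; rewrite -!catA; apply: kred_blocked_bump.
Qed.

(** * Insertion, row by row *)

(** Like its two companions below, used in contrapositive form: a failed test on the whole tableau
    yields a failure in the row or against the row above. *)
Lemma increasing_append above A rest x :
  0 < x -> increasing_tableau (above ++ A :: rest) ->
  all (ltn^~ x) A && fits_below above (rcons A x) ->
  increasing_tableau (above ++ rcons A x :: rest).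
Proof.
move=> x_gt0; rewrite !increasing_tableau_cat !increasing_tableau_cons.
case/and3P=> -> /and3P[/and3P[_ A_pos A_inc] -> A_rest] _ /andP[Ax ->].
rewrite /row_ok size_rcons sorted_ltn_rcons A_inc Ax /positive_word all_rcons x_gt0 /=.
rewrite [all _ A]A_pos /=.
by case: rest A_rest => // R rest; move/lies_above_extend->.
Qed.

Lemma increasing_append_row above x :
  0 < x -> increasing_tableau above -> fits_below above [:: x] ->
  increasing_tableau (rcons above [:: x]).
Proof.
move=> x_gt0 T_inc T_x; rewrite -cats1 increasing_tableau_cat T_inc.
by rewrite increasing_tableau_cons /row_ok /= x_gt0.
Qed.

Lemma increasing_replace above A x y B rest :
  0 < x -> x < y -> increasing_tableau (above ++ (A ++ y :: B) :: rest) ->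
  all (ltn^~ x) A && fits_below above (A ++ x :: B) ->
  increasing_tableau (above ++ (A ++ x :: B) :: rest).
Proof.
move=> x_gt0 xy; rewrite !increasing_tableau_cat !increasing_tableau_cons.
case/and3P=> -> /and3P[/and3P[_]].
rewrite /positive_word all_cat sorted_ltn_cat.
case/and3P=> A_pos _ B_pos /and3P[A_inc _ yB] -> R_rest _ /andP[Ax ->].
rewrite /row_ok size_cat addnS /positive_word all_cat [all _ A]A_pos /= x_gt0.
rewrite [all _ B]B_pos sorted_ltn_cat A_inc Ax /= (path_le ltn_trans xy) //=.
by case: rest R_rest => // R rest; move/(lies_above_lower xy)->.
Qed.

(** The pending letter [x] is read between the rows still to be visited and those already treated.
    Increasingness is proved alongside, since the next insertion requires it. *)
Lemma hecke_insert_from_kred above below x :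
  0 < x -> increasing_tableau (above ++ below) ->
  bump_context above (head [::] below) x ->
  increasing_tableau (hecke_insert_from above below x) /\
  kred (row_word below ++ x :: row_word above)
       (row_word (hecke_insert_from above below x)).
Proof.
elim: below above x => [|R rest IH] above x x_gt0 T_inc ctx /=.
  rewrite cats0 in T_inc; case: ifPn => [T'_inc|T'_ninc]; split=> //.
    by rewrite row_word_rcons; apply: kred_refl.
  (* A missing row counts as an empty one, which makes this an instance of a failed append. *)
  have T_nil : fits_below above [::] by rewrite /fits_below orbT.
  apply: (kred_append_fails T_inc T_nil ctx) => //.
  by apply: contra T'_ninc => /andP[_]; apply: increasing_append_row.
have /and3P[above_inc R_rest QR] :
    [&& increasing_tableau above, increasing_tableau (R :: rest)
      & fits_below above R] by rewrite -increasing_tableau_cat.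
have /and3P[/and3P[_ R_pos R_inc] _ R_below] :
    [&& row_ok R, increasing_tableau rest
      & if rest is R' :: _ then lies_above R R' else true].
  by rewrite -increasing_tableau_cons.
case: ifPn => [Rx|nRx].
  case: ifPn => [T'_inc|T'_ninc]; split=> //.
    rewrite row_word_cat !row_word_cons -!catA -cats1 -catA.
    exact: kred_refl.
  rewrite row_word_cat row_word_cons -!catA; apply: kred_catl.
  apply: kred_append_fails => //.
  by apply: contra T'_ninc; apply: increasing_append.
have [A [y [B [defR Ax xy -> ->]]]] := bumpedP R_inc nRx.
have y_gt0 : 0 < y by apply: leq_trans xy.
(* The witness is the position of [y] in [R]. The next row, if it reaches that far, has a larger
   entry there because [R] lies above it; with no next row the condition is vacuous. *)
have bump_rest R' : size R' = size R -> nth 0 R' (size A) <= y ->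
    bump_context (rcons above R') (head [::] rest) y.
  move=> szR' R'y; right; exists (size A); rewrite last_rcons szR'.
  split=> //; first by rewrite defR size_cat addnS ltnS leq_addr.
  case: rest R_below {IH T_inc R_rest ctx} => [|P rest] //= /lies_aboveP[_ ltR] AP.
  by have := ltR _ AP; rewrite defR nth_cat ltnn subnn.
case: ifPn => [T'_inc|T'_ninc].
  have [||T''_inc T''_kred] := IH (rcons above (A ++ x :: B)) y y_gt0.
  - by rewrite cat_rcons.
  - by apply: bump_rest; rewrite ?defR ?size_cat // nth_cat ltnn subnn ltnW.
  split=> //; apply: kred_trans T''_kred.
  rewrite row_word_cons row_word_rcons -!catA; apply: kred_catl.
  rewrite defR -!catA /= in R_inc *; apply: kred_trans (kred_bump _ xy _ _) _.
  - move: T'_inc; rewrite increasing_tableau_cat increasing_tableau_cons.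
    case/and3P=> _ /andP[/and3P[_ _]]; rewrite -cat_rcons => /cat_sorted2[-> _].
    by [].
  - by move: R_inc; rewrite sorted_ltn_cat => /and3P[].
  exact: kred_refl.
have [||T''_inc T''_kred] := IH (rcons above R) y y_gt0.
- by rewrite cat_rcons.
- by apply: bump_rest; rewrite // defR nth_cat ltnn subnn.
split=> //; apply: kred_trans T''_kred.
rewrite row_word_cons row_word_rcons -!catA; apply: kred_catl.
rewrite /= defR in T_inc QR ctx R_inc *.
apply: kred_replace_fails => //.
by apply: contra T'_ninc; apply: (increasing_replace x_gt0 xy T_inc).
Qed.

Theorem lemma4p4 (w : word) (w_pos : positive_word w) :
  KKnuth_equiv_len (size w) w (row_word (insertion_tableau w)).
Proof.
(* Increasingness of the tableau built so far is carried through the induction on prefixes. *)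
suff [] : increasing_tableau (insertion_tableau w) /\
    kred w (row_word (insertion_tableau w)) by [].
elim/last_ind: w w_pos => [|w x IH] /=; first by split=> //; apply: kred_refl.
rewrite /positive_word all_rcons => /andP[x_gt0 /IH[T_inc w_kred]].
rewrite /insertion_tableau foldl_rcons -/(insertion_tableau w).
have [|T'_inc T'_kred] := @hecke_insert_from_kred [::] _ x x_gt0 T_inc.
  by left.
split=> //; apply: kred_trans T'_kred.
by rewrite -cats1; apply: kred_catr.
Qed.
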